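(* Let $\mathcal Y$ be a finite set, let $k=k(n)\in\{0,\dots,n-1\}$ with $\pi_n:=k/n\to\pi\in[0,1]$, and let the local randomizers $W^{(n)}$ be in the sparse-error critical regime with dominant outputs $(y_0,y_1)$ and intensities $\alpha_0(y)$ $(y\ne y_0)$, $\alpha_1(y)$ $(y\neq y_1)$. Let $P_n$ be the law of $H_{n,k}$ under $T_{n,k}$ and $Q_n$ the law of $H_{n,k}$ under $T_{n,k+1}$ (with the same centering, using $k$). Let $P_\infty:=\mathcal L(H_\infty)$ and $Q_\infty:=\mathcal L(H_\infty+e_{y_1}-e_{y_0})$. Then $$P_n\to P_\infty,\qquad Q_n\to Q_\infty\qquad\text{in total variation.}$$ In particular, $\Delta\bigl((P_n,Q_n),(P_\infty,Q_\infty)\bigr)\to0$. Moreover, with $p_{0,n}:=1-W_0^{(n)}(y_0)$ and $p_{1,n}:=1-W_1^{(n)}(y_1)$, $$\mathrm{TV}(P_n,P_\infty)\le (n-k)p_{0,n}(1-e^{-p_{0,n}})+kp_{1,n}(1-e^{-p_{1,n}})+\sum_{y\ne y_0}\bigl|(n-k)W_0^{(n)}(y)-(1-\pi)\alpha_0(y)\bigr|+\sum_{y\neq y_1}\bigl|kW_1^{(n)}(y)-\pi\alpha_1(y)\bigr|,$$ $$\mathrm{TV}(Q_n,Q_\infty)\le (n-k-1)p_{0,n}(1-e^{-p_{0,n}})+(k+1)p_{1,n}(1-e^{-p_{1,n}})+\sum_{y\ne y_0}\bigl|(n-k-1)W_0^{(n)}(y)-(1-\pi)\alpha_0(y)\bigr|+\sum_{y\neq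 y_1}\bigl|(k+1)W_1^{(n)}(y)-\pi\alpha_1(y)\bigr|.$$ If in addition $|\pi_n-\pi|=O(1/n)$ and $nW_b^{(n)}(y)=\alpha_b(y)+O(1/n)$ for all $b\in\{0,1\}$ and $y\ne y_b$, then the right-hand sides of both bounds are $O(1/n)$.
   Context: For each $n$, $W^{(n)}$ is a Markov kernel from $\{0,1\}$ to the finite alphabet $\mathcal Y$, i.e. two probability vectors $W_0^{(n)},W_1^{(n)}$ on $\mathcal Y$. For $0\le k\le n$, under $T_{n,k}$ there are $n-k$ users with input $0$ and $k$ users with input $1$; independently each user with input $b$ outputs a message drawn from $W_b^{(n)}$, and the released histogram is $N_{n,k}=(N(y))_{y\in\mathcal Y}$, $N(y)$ being the number of users whose message is $y$. Sparse-error critical regime with dominant outputs $(y_0,y_1)$: $y_0\ne y_1$ in $\mathcal Y$, and there are nonnegative reals $\{\alpha_0(y)\}_{y\neq y_0}$, $\{\alpha_1(y)\}_{y\neq y_1}$ such that, as $n\to\infty$, $nW_0^{(n)}(y)\to\alpha_0(y)$ for $y\ne y_0$, $nW_1^{(n)}(y)\to\alpha_1(y)$ for $y\neq y_1$, and $W_0^{(n)}(y_0)\to1$, $W_1^{(n)}(y_1)\to1$. With $e_y$ the standard basis vectors of $\mathbb Z^{\mathcal Y}$, the centered histogram is $H_{n,k}:=N-(n-k)e_{y_0}-ke_{y_1}$, where $N$ is the released histogram (so $N=N_{n,k}$ under $T_{n,k}$ and $N=N_{n,k+1}$ under $T_{n,k+1}$). The limit vector is $$H_\infty:=\sum_{y\ne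 y_0}U_y(e_y-e_{y_0})+\sum_{y\neq y_1}V_y(e_y-e_{y_1}),$$ with all $U_y\sim\mathrm{Poi}((1-\pi)\alpha_0(y))$ and $V_y\sim\mathrm{Poi}(\pi\alpha_1(y))$ mutually independent ($\mathrm{Poi}(0)$ is the point mass at $0$). $\mathrm{TV}(\mu,\nu):=\sup_A|\mu(A)-\nu(A)|$. For binary experiments $(P,Q)$, $(P',Q')$, the deficiency of the first relative to the second is $\inf_K\max\{\mathrm{TV}(PK,P'),\mathrm{TV}(QK,Q')\}$ over Markov kernels $K$; the Le Cam distance $\Delta$ is the maximum of the two deficiencies. *)

(* Defs.v *)
From HB Require Import structures.
From mathcomp Require Import all_boot all_order all_algebra.
From mathcomp Require Import all_classical all_reals all_analysis.

Set Implicit Arguments.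
Unset Strict Implicit.
Unset Printing Implicit Defensive.

Import Order.TTheory GRing.Theory Num.Theory.
Import numFieldNormedType.Exports.

Local Open Scope classical_set_scope.
Local Open Scope ring_scope.

Section statistical_experiments.
Context {R : realType}.
Local Open Scope ereal_scope.

Definition TV d (T : measurableType d) (mu nu : set T -> \bar R) : \bar R :=
  ereal_sup [set `|mu A - nu A| | A in measurable].

(* The measure mu K : A |-> \int K(x, A) mu(dx). *)
Definition apply_kernel d d' (T : measurableType d) (T' : measurableType d')
    (mu : probability T R) (K : R.-pker T ~> T') : set T' -> \bar R :=
  fun A => \int[mu]_x K x A.

(* Deficiency of the experiment (P, Q) relative to (P', Q'). *)
Definition deficiency d d' (T : measurableType d) (T' : measurableType d')
    (P Q : probability T R) (P' Q' : probability T' R) : \bar R :=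
  ereal_inf [set maxe (TV (apply_kernel P K) P') (TV (apply_kernel Q K) Q')
            | K in [set: R.-pker T ~> T']].

Definition le_cam d d' (T : measurableType d) (T' : measurableType d')
    (P Q : probability T R) (P' Q' : probability T' R) : \bar R :=
  maxe (deficiency P Q P' Q') (deficiency P' Q' P Q).

End statistical_experiments.

Record probvec (R : realType) (X : choiceType) := ProbVec {
  probvec_val :> X -> R;
  probvec_ge0 : forall x, 0 <= probvec_val x;
  probvec_sum1 : (\esum_(x in [set: X]) (probvec_val x)%:E = 1)%E }.

Lemma ge0_esumZl (R : realType) (X : choiceType) (c : R) (a : X -> \bar R) :
  0 <= c -> (forall x, 0 <= a x)%E ->
  (\esum_(x in [set: X]) (c%:E * a x) = c%:E * \esum_(x in [set: X]) a x)%E.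
Proof.
have le (b : R) (f : X -> \bar R) : 0 <= b -> (forall x, 0 <= f x)%E ->
    (\esum_(x in [set: X]) (b%:E * f x)
      <= b%:E * \esum_(x in [set: X]) f x)%E.
  move=> b0 f0; apply: ge_ereal_sup => _ [A [finA _] <-].
  rewrite -ge0_mule_fsumr//.
  by apply: lee_wpmul2l; rewrite ?lee_fin//; apply: esum_ge; exists A.
move=> c0 a0; apply/eqP; rewrite eq_le le//=.
have [<-|cn0] := eqVneq 0 c.
  by rewrite mul0e; apply: esum_ge0 => x _; rewrite mul0e.
have {cn0}c0 : 0 < c by rewrite lt_def eq_sym cn0.
rewrite -lee_pdivlMl//.
have cV x : a x = (c^-1%:E * (c%:E * a x))%E.
  by rewrite muleA -EFinM mulVf ?mul1e// gt_eqF.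
under eq_esum do rewrite cV.
apply: (le c^-1 (fun x => c%:E * a x)%E) => [|x].
  by rewrite invr_ge0 ltW.
by rewrite mule_ge0// lee_fin ltW.
Qed.

(* Joint mass function of an independent family (Z_i), Z_i distributed as
   p i. *)
Section product_probvec.
Context {R : realType} {I : finType} {X : choiceType} (p : I -> probvec R X).

Definition prod_fun (z : {ffun I -> X}) : R := \prod_i p i (z i).

Lemma prod_fun_ge0 z : 0 <= prod_fun z.
Proof. by apply: prodr_ge0 => i _; exact: probvec_ge0. Qed.

Lemma esum_prod_ord n (q : 'I_n -> probvec R X) :
  (\esum_(z in [set: {ffun 'I_n -> X}]) (\prod_i q i (z i))%:E = 1)%E.
Proof.
elim: n q => [|n IHn] q.
  have e0 (z : {ffun 'I_0 -> X}) : z = ffun0 (card_ord 0).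
    by apply/ffunP => -[].
  rewrite (_ : [set: _] = [set ffun0 (card_ord 0)]); last first.
    by apply/seteqP; split=> z //= _; rewrite [LHS]e0.
  by rewrite esum_set1 ?big_ord0 ?lee_fin.
pose e (u : X * {ffun 'I_n -> X}) : {ffun 'I_n.+1 -> X} :=
  [ffun i => oapp u.2 u.1 (unlift ord0 i)].
have be : set_bij ([set: X] `*`` fun=> [set: {ffun 'I_n -> X}])
    [set: {ffun 'I_n.+1 -> X}] e.
  split => //.
  - move=> [x z] [x' z'] _ _ /ffunP eE; congr pair.
      by have := eE ord0; rewrite !ffunE unlift_none.
    by apply/ffunP => i; have := eE (lift ord0 i); rewrite !ffunE liftK.
  - move=> z _; exists (z ord0, [ffun i => z (lift ord0 i)]) => //.
    apply/ffunP => i; rewrite ffunE /=.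
    by case: unliftP => [j ->|->] //=; rewrite ffunE.
rewrite (reindex_esum _ _ e _ be).
rewrite (eq_esum (b := fun u : X * {ffun 'I_n -> X} => ((q ord0 u.1)%:E *
    (\prod_i q (lift ord0 i) (u.2 i))%:E)%E)); last first.
  move=> [x z] _; rewrite -EFinM big_ord_recl ffunE unlift_none /=.
  by congr (_ * _)%:E; apply: eq_bigr => i _; rewrite ffunE liftK.
rewrite -(esum_esum (a := fun x (z : {ffun 'I_n -> X}) => ((q ord0 x)%:E *
    (\prod_i q (lift ord0 i) (z i))%:E)%E)); last first.
  move=> x z _ _; rewrite mule_ge0 ?lee_fin ?probvec_ge0//.
  by apply: prodr_ge0 => i _; exact: probvec_ge0.
rewrite -(probvec_sum1 (q ord0)); apply: eq_esum => x _.
rewrite ge0_esumZl ?probvec_ge0// => [|z].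
  by rewrite (IHn (fun i => q (lift ord0 i))) mule1.
by rewrite lee_fin; apply: prodr_ge0 => i _; exact: probvec_ge0.
Qed.

Lemma prod_fun_sum1 :
  (\esum_(z in [set: {ffun I -> X}]) (prod_fun z)%:E = 1)%E.
Proof.
rewrite -(esum_prod_ord (fun i : 'I_#|I| => p (enum_val i))).
pose e (z : {ffun 'I_#|I| -> X}) : {ffun I -> X} :=
  [ffun i => z (enum_rank i)].
have be : set_bij [set: {ffun 'I_#|I| -> X}] [set: {ffun I -> X}] e.
  split => //.
  - move=> z z' _ _ /ffunP eE; apply/ffunP => i.
    by have := eE (enum_val i); rewrite !ffunE enum_valK.
  - move=> z _; exists [ffun i => z (enum_val i)] => //.
    by apply/ffunP => i; rewrite !ffunE enum_rankK.
rewrite (reindex_esum _ _ e _ be); apply: eq_esum => z _; congr (_%:E).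
rewrite /prod_fun (reindex (@enum_val I predT)) /=; last first.
  by exists enum_rank => i _; rewrite ?enum_valK ?enum_rankK.
by apply: eq_bigr => i _; rewrite ffunE enum_valK.
Qed.

Definition prod_probvec : probvec R {ffun I -> X} :=
  ProbVec prod_fun_ge0 prod_fun_sum1.

End product_probvec.

(* [poisson_prob r] is the point mass at 0 when r = 0 (whereas the library's
   [poisson_pmf 0] is not a mass function); its second argument is a dummy. *)
Section poisson.
Context {R : realType} (r : R).

Definition poi_fun (j : nat) : R := fine (poisson_prob r 0 [set j]).

Lemma poi_fun_ge0 j : 0 <= poi_fun j.
Proof. by apply: fine_ge0; exact: measure_ge0. Qed.

Lemma poi_fun_sum1 : (\esum_(j in [set: nat]) (poi_fun j)%:E = 1)%E.
Proof.
rewrite -(probability_setT (poisson_prob r 0)).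
rewrite (_ : [set: nat] = \bigcup_j [set j]); last first.
  by apply/seteqP; split => // j _; exists j.
rewrite measure_bigcup//; last by move=> i j _ _ [k [/= -> ->]].
rewrite (_ : \bigcup_j [set j] = [set: nat]); last first.
  by apply/seteqP; split => // j _; exists j.
rewrite -nneseries_esumT => [|j]; last by rewrite lee_fin poi_fun_ge0.
under [RHS]eq_eseriesl do rewrite in_setT.
apply: eq_eseriesr => j _.
by rewrite /poi_fun fineK// fin_num_measure.
Qed.

Definition poi : probvec R nat := ProbVec poi_fun_ge0 poi_fun_sum1.

End poisson.

(* Z^Y, with the sigma-algebra of all subsets. *)
Definition Zvec (Y : finType) : Type := {ffun Y -> int}.

HB.instance Definition _ (Y : finType) := GRing.Zmodule.on (Zvec Y).
HB.instance Definition _ (Y : finType) := isPointed.Build (Zvec Y) 0.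
HB.instance Definition _ (Y : finType) :=
  @isMeasurable.Build default_measure_display (Zvec Y) discrete_measurable
    discrete_measurable0 discrete_measurableC discrete_measurableU.

Definition basis_vec (Y : finType) (y : Y) : Zvec Y :=
  [ffun z => ((z == y) : nat)%:Z].

Section law.
Context {R : realType} {X : choiceType} {Y : finType}.

(* Law of the random vector H when the sample point has mass function p. *)
Definition law (p : probvec R X) (H : X -> Zvec Y) : set (Zvec Y) -> \bar R :=
  fun A => (\esum_(x in H @^-1` A) (p x)%:E)%E.

Variables (p : probvec R X) (H : X -> Zvec Y).

Let law0 : law p H set0 = 0%E.
Proof. by rewrite /law preimage_set0 esum_set0. Qed.

Let law_ge0 A : (0 <= law p H A)%E.
Proof. by apply: esum_ge0 => x _; rewrite lee_fin probvec_ge0. Qed.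

Let law_sigma_additive : semi_sigma_additive (law p H).
Proof.
move=> F mF tF mUF; rewrite /law preimage_bigcup; apply: cvg_toP.
  apply: ereal_nondecreasing_is_cvgn => a b ab.
  by apply: lee_sum_nneg_natr => // n _ _; exact: law_ge0.
rewrite nneseries_sum_bigcup// => [|x]; last by rewrite lee_fin probvec_ge0.
by move=> i j _ _ [x [Fix Fjx]]; apply: tF => //; exists (H x).
Qed.

HB.instance Definition _ := isMeasure.Build _ _ _ (law p H)
  law0 law_ge0 law_sigma_additive.

Let law_setT : law p H [set: Zvec Y] = 1%E.
Proof. by rewrite /law preimage_setT probvec_sum1. Qed.

HB.instance Definition _ := Measure_isProbability.Build _ _ _ (law p H)
  law_setT.

End law.

Section shuffle_histograms.
Context {R : realType} {Y : finType}.

(* A local randomizer is a Markov kernel W from bool ({0,1}) to Y: the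
   probability vectors W_0 = W false and W_1 = W true. *)

Definition histogram n (m : {ffun 'I_n -> Y}) : Zvec Y :=
  [ffun y => #|[set i | m i == y]|%:Z].

(* Messages of n users under T_{n,j} (j <= n): they are independent, and the
   users with input 1 are the first j ones, which is no restriction since
   only the law of the histogram, a symmetric function, is used. *)
Definition messages (W : bool -> probvec R Y) (n j : nat) :
    probvec R {ffun 'I_n -> Y} :=
  prod_probvec (fun i : 'I_n => W (i < j)%N).

Definition centered (y0 y1 : Y) (n k : nat) (N : Zvec Y) : Zvec Y :=
  N - basis_vec y0 *+ (n - k) - basis_vec y1 *+ k.

(* Law of H_{n,k} under T_{n,j}; the centering uses k. *)
Definition centered_law (W : bool -> probvec R Y) (y0 y1 : Y) (n k j : nat) :
    probability (Zvec Y) R :=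
  law (messages W n j) (fun m => centered y0 y1 n k (histogram m)).

(* A point UV of the sample space holds all the Poisson variables:
   U_y = UV (false, y) and V_y = UV (true, y). The coordinates U_{y0} and
   V_{y1} are superfluous, [H_limit] does not depend on them. *)
Definition poisson_family (pi_lim : R) (alpha0 alpha1 : Y -> R) :
    probvec R {ffun bool * Y -> nat} :=
  prod_probvec (fun by_ : bool * Y =>
    poi (if by_.1 then pi_lim * alpha1 by_.2 else (1 - pi_lim) * alpha0 by_.2)).

Definition H_limit (y0 y1 : Y) (UV : {ffun bool * Y -> nat}) : Zvec Y :=
  \sum_(y | y != y0) (basis_vec y - basis_vec y0) *+ UV (false, y)
  + \sum_(y | y != y1) (basis_vec y - basis_vec y1) *+ UV (true, y).

Definition P_limit (pi_lim : R) (y0 y1 : Y) (alpha0 alpha1 : Y -> R) :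
    probability (Zvec Y) R :=
  law (poisson_family pi_lim alpha0 alpha1) (H_limit y0 y1).

Definition Q_limit (pi_lim : R) (y0 y1 : Y) (alpha0 alpha1 : Y -> R) :
    probability (Zvec Y) R :=
  law (poisson_family pi_lim alpha0 alpha1)
    (fun UV => H_limit y0 y1 UV + basis_vec y1 - basis_vec y0).

(* The values alpha0 y0 and alpha1 y1 are junk. *)
Record sparse_error_critical (W : nat -> bool -> probvec R Y) (y0 y1 : Y)
    (alpha0 alpha1 : Y -> R) : Prop := SparseErrorCritical {
  dominant_neq : y0 != y1;
  intensity0_ge0 : forall y, y != y0 -> 0 <= alpha0 y;
  intensity1_ge0 : forall y, y != y1 -> 0 <= alpha1 y;
  intensity0_cvg : forall y, y != y0 ->
    n%:R * W n false y @[n --> \oo] --> alpha0 y;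
  intensity1_cvg : forall y, y != y1 ->
    n%:R * W n true y @[n --> \oo] --> alpha1 y;
  dominant0_cvg : W n false y0 @[n --> \oo] --> (1 : R);
  dominant1_cvg : W n true y1 @[n --> \oo] --> (1 : R) }.

(* The total variation bound for a users with input 0 and b users with
   input 1: (a, b) = (n - k, k) for P_n and (n - k - 1, k + 1) for Q_n. *)
Definition tv_bound (W : bool -> probvec R Y) (pi_lim : R) (y0 y1 : Y)
    (alpha0 alpha1 : Y -> R) (a b : nat) : R :=
  let p0 := 1 - W false y0 in
  let p1 := 1 - W true y1 in
  a%:R * p0 * (1 - expR (- p0)) + b%:R * p1 * (1 - expR (- p1))
  + \sum_(y | y != y0) `|a%:R * W false y - (1 - pi_lim) * alpha0 y|
  + \sum_(y | y != y1) `|b%:R * W true y - pi_lim * alpha1 y|.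

End shuffle_histograms.

(* Main.v *)
(* Le Cam's operator method. A random vector Z acts on functions with values in
   [0, 1] by f |-> (g |-> E f(g + Z)); these operators are monotone, fix the
   constants, and those of independent vectors compose to the one of the sum.
   The message of one user moves the centered histogram by e_y - e_{y_b} with
   probability W_b(y), and the Poisson vector with the same rates puts at least
   exp(-p) and exp(-p) W_b(y) on the corresponding values, so that the two
   operators differ by at most p (1 - exp(-p)), p being the error probability.
   Exchanging the users one after the other adds these errors up. The Poisson
   vectors of all users sum up to one Poisson vector, and changing a Poisson
   rate from a to b costs at most |a - b|, because Poi(a + c) is the convolution
   of Poi(a) and Poi(c) and Poi(c) is 0 up to a probability c. Only one-sided
   bounds are needed: complements of events give the other side. *)
Require Import Defs.
From HB Require Import structures.
From mathcomp Require Import all_boot all_order all_algebra.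
From mathcomp Require Import all_classical all_reals all_analysis.
From mathcomp Require Import ring lra.

Set Implicit Arguments.
Unset Strict Implicit.
Unset Printing Implicit Defensive.

Import Order.TTheory GRing.Theory Num.Theory.
Import numFieldNormedType.Exports.

Local Open Scope classical_set_scope.
Local Open Scope ring_scope.

(** * Convolution operators *)

Section convolution.
Context {R : realType} {G : zmodType}.
Local Open Scope ereal_scope.
Implicit Types (f : G -> \bar R) (g v : G).

(** Extended-real values let [\esum] be used with no summability hypothesis; nonnegativity of [f]
    takes its place throughout. *)
Definition convol {X : choiceType} (p : probvec R X) (h : X -> G) f g : \bar R :=
  \esum_(x in [set: X]) ((p x)%:E * f (g + h x)%R).

Definition convol_seq {X I : choiceType} (p : I -> probvec R X) (h : I -> X -> G)
    (r : seq I) f : G -> \bar R :=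
  foldr (fun i => convol (p i) (h i)) f r.

Section one.
Context {X : choiceType} (p : probvec R X) (h : X -> G).

Lemma convol_ge0 f g : (forall g, 0 <= f g) -> 0 <= convol p h f g.
Proof.
by move=> f0; apply: esum_ge0 => x _; rewrite mule_ge0 ?lee_fin ?probvec_ge0.
Qed.

Lemma le_convol f f' g : (forall g, f g <= f' g) -> convol p h f g <= convol p h f' g.
Proof.
by move=> ff'; apply: le_esum => x _; rewrite lee_wpmul2l ?lee_fin ?probvec_ge0.
Qed.

Lemma convolD f f' g : (forall g, 0 <= f g) -> (forall g, 0 <= f' g) ->
  convol p h (fun g => f g + f' g) g = convol p h f g + convol p h f' g.
Proof.
move=> f0 f'0; rewrite /convol -esumD => [|x _|x _];
  try by rewrite mule_ge0 ?lee_fin ?probvec_ge0.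
by apply: eq_esum => x _; rewrite ge0_muleDr.
Qed.

Lemma convol_cst (c : R) g : (0 <= c)%R -> convol p h (fun=> c%:E) g = c%:E.
Proof.
move=> c0; rewrite /convol; under eq_esum do rewrite muleC.
rewrite ge0_esumZl ?probvec_sum1 ?mule1// => x.
by rewrite lee_fin probvec_ge0.
Qed.

Lemma convolDcst f (c : R) g : (0 <= c)%R -> (forall g, 0 <= f g) ->
  convol p h (fun g => f g + c%:E) g = convol p h f g + c%:E.
Proof.
by move=> c0 f0; rewrite (convolD (f' := fun=> c%:E)) ?convol_cst.
Qed.

Lemma convol_le1 f g : (forall g, f g <= 1) -> convol p h f g <= 1.
Proof.
by move=> f1; rewrite -[leRHS](convol_cst g ler01); exact: le_convol.
Qed.

Lemma convol0 f g : (forall x, h x = 0%R) -> 0 <= f g <= 1 -> convol p h f g = f g.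
Proof.
move=> h0 /andP[f0 f1]; rewrite /convol.
under eq_esum do rewrite h0 addr0 muleC.
have p0 x : 0 <= (p x)%:E by rewrite lee_fin probvec_ge0.
case: (f g) f0 f1 => // c c0 _.
by rewrite ge0_esumZl// probvec_sum1 mule1.
Qed.

End one.

(** By Tonelli both sides are the same nonnegative sum over pairs; commutativity of [G] exchanges
    the two jumps. *)
Lemma convolC {X X' : choiceType} (p : probvec R X) (h : X -> G)
    (p' : probvec R X') (h' : X' -> G) f g :
  (forall g, 0 <= f g) ->
  convol p h (convol p' h' f) g = convol p' h' (convol p h f) g.
Proof.
move=> f0.
have e (Z Z' : choiceType) (q : probvec R Z) (k : Z -> G)
    (q' : probvec R Z') (k' : Z' -> G) : convol q k (convol q' k' f) g =
    \esum_(u in [set: Z] `*`` (fun=> [set: Z']))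
      ((q u.1 * q' u.2)%:E * f (g + k u.1 + k' u.2)%R).
  rewrite -(esum_esum (a := fun x y => (q x * q' y)%:E *
    f (g + k x + k' y)%R)); last first.
    by move=> x y _ _; rewrite mule_ge0 ?lee_fin ?mulr_ge0 ?probvec_ge0.
  apply: eq_esum => x _; rewrite -ge0_esumZl ?probvec_ge0//.
    by apply: eq_esum => y _; rewrite EFinM muleA.
  by move=> y; rewrite mule_ge0 ?lee_fin ?probvec_ge0.
rewrite !e.
rewrite (reindex_esum ([set: X'] `*`` (fun=> [set: X])) _ (fun x => (x.2, x.1)));
  last first.
  by split=> // [[x y] [x' y'] _ _ [-> ->]//|[x y] _]; exists (y, x).
by apply: eq_esum => -[x y] _ /=; rewrite mulrC addrAC.
Qed.

Lemma convol_seq_ge0 {X I : choiceType} (p : I -> probvec R X) (h : I -> X -> G) r f g :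
  (forall g, 0 <= f g) -> 0 <= convol_seq p h r f g.
Proof. by move=> f0; elim: r g => //= i r IH g; exact: convol_ge0. Qed.

Lemma convol_seq_le1 {X I : choiceType} (p : I -> probvec R X) (h : I -> X -> G) r f g :
  (forall g, f g <= 1) -> convol_seq p h r f g <= 1.
Proof. by move=> f0; elim: r g => //= i r IH g; exact: convol_le1. Qed.

Lemma convol_seqC {X X' I : choiceType} (q : probvec R X') (k : X' -> G)
    (p : I -> probvec R X) (h : I -> X -> G) r f g :
  (forall g, 0 <= f g) ->
  convol q k (convol_seq p h r f) g = convol_seq p h r (convol q k f) g.
Proof.
move=> f0; elim: r g => //= i r IH g.
rewrite convolC; last by move=> ?; exact: convol_seq_ge0.
by congr (convol _ _ _ g); apply/funext.
Qed.

(** Hybrid argument. The one-step comparison holds for every test function, so it applies to the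
    remaining composition, which again takes values in [0, 1]; the errors of the inner steps are
    constants and pass through the outer operators unchanged. *)
Lemma convol_seq_telescope {X X' I : choiceType} (p : I -> probvec R X)
    (h : I -> X -> G) (q : I -> probvec R X') (k : I -> X' -> G)
    (eps : I -> R) (r : seq I) f g :
  (forall i, (0 <= eps i)%R) ->
  (forall i f g, (forall g, 0 <= f g <= 1) ->
    convol (p i) (h i) f g <= convol (q i) (k i) f g + (eps i)%:E) ->
  (forall g, 0 <= f g <= 1) ->
  convol_seq p h r f g <= convol_seq q k r f g + (\sum_(i <- r) eps i)%R%:E.
Proof.
move=> eps0 pq f01; elim: r g => [|i r IH] g; first by rewrite big_nil adde0.
rewrite big_cons/= EFinD addeA.
have s0 : (0 <= \sum_(j <- r) eps j)%R by apply: sumr_ge0.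
have F0 g' : 0 <= f g' by have /andP[] := f01 g'.
have F1 g' : f g' <= 1 by have /andP[] := f01 g'.
apply: (@le_trans _ _ (convol (p i) (h i)
    (fun g => convol_seq q k r f g + (\sum_(j <- r) eps j)%:E) g)).
  exact: le_convol.
rewrite convolDcst//; last by move=> ?; exact: convol_seq_ge0.
rewrite leeD2r//; apply: pq => g'.
by rewrite convol_seq_ge0// convol_seq_le1.
Qed.

(** Independence: the product mass factors, so splitting off the coordinate [ord0] and summing the
    others first peels off one operator per induction step. *)
Lemma convol_prod_ord {X : choiceType} n (p : 'I_n -> probvec R X)
    (h : 'I_n -> X -> G) f g : (forall g, 0 <= f g) ->
  convol (prod_probvec p) (fun z => \sum_i h i (z i))%R f g =
  convol_seq p h (enum 'I_n) f g.
Proof.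
move=> f0; elim: n p h g => [|n IHn] p h g.
  rewrite enum_ord0 /convol (_ : [set: _] = [set ffun0 (card_ord 0)]).
    by rewrite esum_set1 /= /prod_fun !big_ord0 ?addr0 ?mul1e.
  by apply/seteqP; split=> z //= _; apply/ffunP => -[].
pose e (u : X * {ffun 'I_n -> X}) : {ffun 'I_n.+1 -> X} :=
  [ffun i => oapp u.2 u.1 (unlift ord0 i)].
have e0 u : e u ord0 = u.1 by rewrite ffunE unlift_none.
have eS u i : e u (lift ord0 i) = u.2 i by rewrite ffunE liftK.
have be : set_bij ([set: X] `*`` fun=> [set: {ffun 'I_n -> X}])
    [set: {ffun 'I_n.+1 -> X}] e.
  split=> // [u u' _ _ uu'|z _].
    rewrite [u]surjective_pairing [u']surjective_pairing -!e0 uu'; congr pair.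
    by apply/ffunP => i; rewrite -!eS uu'.
  exists (z ord0, [ffun i => z (lift ord0 i)]) => //; apply/ffunP => i.
  by case: (unliftP ord0 i) => [j|] ->; rewrite (e0, eS) ?ffunE.
rewrite /convol (reindex_esum _ _ e _ be).
rewrite (eq_esum (b := fun u : X * {ffun 'I_n -> X} => (p ord0 u.1)%:E *
    ((prod_fun (fun i => p (lift ord0 i)) u.2)%:E *
     f (g + h ord0 u.1 + \sum_i h (lift ord0 i) (u.2 i))%R))); last first.
  move=> u _; rewrite muleA -EFinM /= /prod_fun !big_ord_recl !e0 addrA.
  congr (_%:E * f (_ + _)%R).
    by congr (_ * _)%R; apply: eq_bigr => i _; rewrite eS.
  by apply: eq_bigr => i _; rewrite eS.
rewrite -(esum_esum (a := fun x z => (p ord0 x)%:E *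
    ((prod_fun (fun i => p (lift ord0 i)) z)%:E *
     f (g + h ord0 x + \sum_i h (lift ord0 i) (z i))%R))); last first.
  by move=> x z _ _; rewrite !mule_ge0 ?lee_fin ?prod_fun_ge0 ?probvec_ge0.
rewrite enum_ordSl /= /convol; apply: eq_esum => x _.
rewrite ge0_esumZl ?probvec_ge0//; last first.
  by move=> z; rewrite mule_ge0 ?lee_fin ?prod_fun_ge0.
congr (_ * _). etransitivity; first exact: (IHn _ (fun i => h (lift ord0 i))).
by rewrite /convol_seq [in RHS]foldr_map.
Qed.

Lemma convol_prod {X : choiceType} {I : finType} (p : I -> probvec R X)
    (h : I -> X -> G) f g : (forall g, 0 <= f g) ->
  convol (prod_probvec p) (fun z => \sum_i h i (z i))%R f g =
  convol_seq p h (enum I) f g.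
Proof.
move=> f0.
pose e (z : {ffun 'I_#|I| -> X}) : {ffun I -> X} := [ffun i => z (enum_rank i)].
have ev z i : e z (enum_val i) = z i by rewrite ffunE enum_valK.
have be : set_bij [set: {ffun 'I_#|I| -> X}] [set: {ffun I -> X}] e.
  split=> // [z z' _ _ zz'|z _].
    by apply/ffunP => i; rewrite -!ev zz'.
  exists [ffun i => z (enum_val i)] => //.
  by apply/ffunP => i; rewrite !ffunE enum_rankK.
transitivity (convol (prod_probvec (fun i : 'I_#|I| => p (enum_val i)))
    (fun z => \sum_i h (enum_val i) (z i))%R f g).
  rewrite /convol (reindex_esum _ _ e _ be); apply: eq_esum => z _ /=.
  have bv : {on [pred i | true], bijective (@enum_val I predT)}.
    by exists enum_rank => i _; rewrite ?enum_valK ?enum_rankK.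
  rewrite /prod_fun (reindex (@enum_val I predT)) //=.
  rewrite [in f _](reindex (@enum_val I predT)) //=.
  by congr (_%:E * f (_ + _)%R); apply: eq_bigr => i _; rewrite ev.
etransitivity.
  exact: (convol_prod_ord _ (fun i : 'I_#|I| => h (enum_val i))).
rewrite /convol_seq -(foldr_map (@enum_val I predT)
  (fun i => convol (p i) (h i))).
(* [enum_val_nth] requires a default element of [I], whence the separate case of an empty index
   type. *)
congr (foldr _ _ _ _); have [x _|I0] := pickP {: I}; last first.
  have cI : #|I| = 0%N by rewrite (eq_card I0) card0.
  transitivity ([::] : seq I); last by apply/esym/size0nil; rewrite -cardE.
  by apply: size0nil; rewrite size_map size_enum_ord.
under eq_map do rewrite (enum_val_nth x).
by rewrite map_comp val_enum_ord cardE; exact: mkseq_nth.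
Qed.

End convolution.

(** The probability of an event is the expectation of its indicator. A deterministic shift of the
    vector becomes the base point [g], which is how the shift of the second hypothesis enters
    later. *)
Lemma law_convol (R : realType) (X : choiceType) (Y : finType)
    (p : probvec R X) (H H' : X -> Zvec Y) (A : set (Zvec Y))
    (g : Zvec Y) : (forall x, H' x = g + H x) ->
  law p H' A = convol p H (EFin \o \1_A) g.
Proof.
move=> HE; rewrite /law esum_mkcond; apply: eq_esum => x _; rewrite /= indicE -HE.
have -> : (x \in H' @^-1` A) = (H' x \in A) by apply/idP/idP; rewrite !inE.
by case: ifP => _; rewrite (mule1, mule0).
Qed.

(** * Poisson operators *)

Section poisson_convolution.
Context {R : realType} {G : zmodType}.
Local Open Scope ereal_scope.
Implicit Types (f : G -> \bar R) (g v : G) (a b : R).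

Definition jumps v (j : nat) : G := (v *+ j)%R.

(** The formula includes a = 0, because [0 ^+ 0 = 1] yields the point mass at 0. *)
Lemma poiE a j : (0 <= a)%R -> poi a j = (a ^+ j / j`!%:R * expR (- a))%R.
Proof.
rewrite /= /poi_fun /poisson_prob le_eqVlt => /predU1P[<-|a0]; last first.
  by rewrite a0 esum_set1 ?lee_fin ?poisson_pmf_ge0//= /poisson_pmf a0.
rewrite ltxx diracE oppr0 expR0 mulr1 /=.
case: j => [|j]; first by rewrite expr0 fact0 invr1 mulr1 mem_set.
by rewrite expr0n mul0r memNset.
Qed.

(** The binomial theorem for (a + b)^m, with binomial coefficients rewritten as quotients of
    factorials by [bin_fact]. *)
Lemma poi_sum a b m : (0 <= a)%R -> (0 <= b)%R ->
  (\sum_(j < m.+1) poi a j * poi b (m - j)%N = poi (a + b) m)%R.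
Proof.
move=> a0 b0; rewrite poiE ?addr_ge0// addrC exprDn opprD expRD !mulr_suml.
apply: eq_bigr => j _; rewrite !poiE//.
have jm : (j <= m)%N by rewrite -ltnS.
have F n : (n`!%:R != 0 :> R)%R by rewrite pnatr_eq0 -lt0n fact_gt0.
have := bin_fact jm => /(congr1 (fun n => n%:R : R)%R); rewrite !natrM => <-.
rewrite -[in RHS](mulr_natr _ 'C(m, j)); field.
by rewrite !F pnatr_eq0 -lt0n bin_gt0 jm.
Qed.

Lemma convol_poiD a b v f g : (0 <= a)%R -> (0 <= b)%R -> (forall g, 0 <= f g) ->
  convol (poi a) (jumps v) (convol (poi b) (jumps v) f) g =
  convol (poi (a + b)) (jumps v) f g.
Proof.
move=> a0 b0 f0.
pose F j l := (poi a j * poi b l)%:E * f (g + v *+ (j + l))%R.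
have F0 j l : 0 <= F j l.
  by rewrite mule_ge0 ?lee_fin ?mulr_ge0 ?probvec_ge0.
transitivity (\esum_(u in [set: nat] `*`` (fun=> [set: nat])) F u.1 u.2).
  rewrite -esum_esum//; apply: eq_esum => j _.
  rewrite -ge0_esumZl ?probvec_ge0// => [|l].
    by apply: eq_esum => l _; rewrite /F EFinM muleA /jumps mulrnDr addrA.
  by rewrite mule_ge0 ?lee_fin ?probvec_ge0.
(* The counts (j, l) are recorded as (j + l, j): grouping by the total m leaves the finite range j
   <= m, on which [poi_sum] applies. *)
pose e (u : nat * nat) := ((u.1 + u.2)%N, u.1).
transitivity (\esum_(u in [set: nat] `*`` (fun m => `I_m.+1)) F u.2 (u.1 - u.2)%N).
  rewrite [RHS](reindex_esum ([set: nat] `*`` (fun=> [set: nat])) _ e).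
    by apply: eq_esum => -[j l] _ /=; rewrite addKn.
  split=> [[j l] _|[j l] [j' l'] _ _ /= [jl jj']|[m j] [_ /= jm]].
  - by split=> //=; rewrite ltnS leq_addr.
  - by move: jl; rewrite jj' => /addnI ->.
  - by exists (j, (m - j)%N) => //; rewrite /e /= subnKC.
rewrite -(esum_esum (a := fun m j => F j (m - j)%N))//.
apply: eq_esum => m _; rewrite esum_fset//.
rewrite -(fsbig_ord _ _ (fun j => F j (m - j)%N)) -poi_sum// -sumEFin.
rewrite ge0_sume_distrl => [|j _]; last first.
  by rewrite lee_fin mulr_ge0// probvec_ge0.
by apply: eq_bigr => j _; rewrite /F subnKC// -ltnS.
Qed.

Lemma convol_poi0 v f g : (forall g, 0 <= f g) ->
  convol (poi 0) (jumps v) f g = f g.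
Proof.
move=> f0; rewrite /convol (esumID [set 0%N])//; last first.
  by move=> j _; rewrite mule_ge0 ?lee_fin ?probvec_ge0.
rewrite setTI esum_set1; last by rewrite mule_ge0 ?lee_fin ?probvec_ge0.
rewrite esum1 ?adde0.
  by rewrite poiE// expr0 fact0 oppr0 expR0 invr1 !mulr1 mul1e /jumps mulr0n addr0.
move=> [|j] [_ j0]; first by case: j0.
by rewrite poiE// expr0n mul0r mul0r mul0e.
Qed.

(** Only the terms j = 0 and j = 1 of the series are kept. *)
Lemma convol_poi_ge a v f g : (0 <= a)%R -> (forall g, 0 <= f g) ->
  (expR (- a))%:E * (f g + a%:E * f (g + v)%R) <= convol (poi a) (jumps v) f g.
Proof.
move=> a0 f0; apply: esum_ge; exists `I_2; first by split=> //; exact: finite_II.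
rewrite -(fsbig_ord _ _ (fun j => (poi a j)%:E * f (g + jumps v j)%R)).
rewrite !big_ord_recl big_ord0 !poiE// /bump/= adde0 expr0 expr1 fact0 /jumps.
rewrite mulr0n mulr1n addr0 divr1 mul1r divr1.
rewrite ge0_muleDr ?mule_ge0//.
by rewrite muleA -EFinM [(a * _)%R]mulrC.
Qed.

(** No jump occurs with probability exp(-a) >= 1 - a, and since f <= 1 the missing mass costs at
    most a. *)
Lemma le_convol_poi a v f g : (0 <= a)%R -> (forall g, 0 <= f g <= 1) ->
  f g <= convol (poi a) (jumps v) f g + a%:E.
Proof.
move=> a0 f01; have f0 g' : 0 <= f g' by have /andP[] := f01 g'.
apply: (@le_trans _ _ ((expR (- a))%:E * f g + a%:E)); last first.
  rewrite leeD2r//; apply: le_trans (convol_poi_ge v g a0 f0).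
  by rewrite lee_wpmul2l ?lee_fin ?expR_ge0// leeDl// mule_ge0.
have /andP[] := f01 g; case: (f g) => // c; rewrite -EFinM -EFinD !lee_fin => c0 c1.
have := expR_ge1Dx (- a); nra.
Qed.

(** This is [le_convol_poi] for the complementary test function [1 - f]; finiteness of all the
    values makes the subtraction legitimate. *)
Lemma ge_convol_poi a v f g : (0 <= a)%R -> (forall g, 0 <= f g <= 1) ->
  convol (poi a) (jumps v) f g <= f g + a%:E.
Proof.
move=> a0 f01.
have f0 g' : 0 <= f g' by have /andP[] := f01 g'.
have ffin g' : f g' \is a fin_num.
  by rewrite fin_numElt (lt_le_trans _ (f0 g'))// (le_lt_trans (andP (f01 g')).2)// ltry.
have cf01 g' : 0 <= 1 - f g' <= 1.
  by have /andP[f0' f1] := f01 g'; rewrite sube_ge0 ?ffin ?orbT// f1 geeDl ?oppe_le0.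
have := le_convol_poi v g a0 cf01.
have := convol_cst (poi a) (jumps v) g (@ler01 R).
rewrite -(_ : (fun g => f g + (1 - f g)) = fun=> 1%:E); last first.
  by apply/funext => g'; rewrite addeC subeK// ffin.
rewrite convolD//; last by move=> g'; have /andP[] := cf01 g'.
have := convol_ge0 (poi a) (jumps v) g f0.
have := convol_ge0 (poi a) (jumps v) g (fun g' => (andP (cf01 g')).1).
move: (ffin g); case: (f g) => // c _.
case: (convol _ _ _ _) => [x||]; case: (convol _ _ _ _) => [y||]//.
rewrite -!EFinD !lee_fin => _ _ -[]; lra.
Qed.

Lemma convol_poi_dist a b v f g : (0 <= a)%R -> (0 <= b)%R ->
  (forall g, 0 <= f g <= 1) ->
  convol (poi a) (jumps v) f g <= convol (poi b) (jumps v) f g + `|a - b|%:E.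
Proof.
move=> a0 b0 f01; have f0 g' : 0 <= f g' by have /andP[] := f01 g'.
have f1 g' : f g' <= 1 by have /andP[] := f01 g'.
have split_le (x y : R) : (x <= y)%R -> exists2 c, (0 <= c)%R & y = (x + c)%R.
  by move=> xy; exists (y - x)%R; [rewrite subr_ge0|rewrite addrC subrK].
(* If a <= b, the spare rate c is inserted under the operator of rate a, by monotonicity; otherwise
   it is moved outermost and removed there. *)
have [/split_le[c c0 ->]|/ltW/split_le[c c0 ->]] := leP a b.
  rewrite opprD addNKr normrN ger0_norm// -convol_poiD// -convolDcst//.
    by apply: le_convol => g'; exact: le_convol_poi.
  by move=> ?; exact: convol_ge0.
rewrite addrAC subrr add0r ger0_norm// [(b + c)%R]addrC -convol_poiD//.
apply: ge_convol_poi => // g'.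
by rewrite convol_ge0// convol_le1.
Qed.

End poisson_convolution.

(** * Operators of compound Poisson vectors *)

Section poisson_vector.
Context {R : realType} {G : zmodType}.
Local Open Scope ereal_scope.

(** Operator of the compound Poisson vector with jumps [v i] performed independently Poi([lam i])
    times. *)
Definition cpoi {I : choiceType} (lam : I -> R) (v : I -> G) (r : seq I) :
    (G -> \bar R) -> G -> \bar R :=
  convol_seq (fun i => poi (lam i)) (fun i => jumps (v i)) r.

Section seq_index.
Context {I : choiceType} (v : I -> G).
Implicit Types (lam : I -> R) (r : seq I) (f : G -> \bar R).

Lemma cpoi_ge0 lam r f g : (forall g, 0 <= f g) -> 0 <= cpoi lam v r f g.
Proof. exact: convol_seq_ge0. Qed.

Lemma cpoi0 r f g : (forall g, 0 <= f g) -> cpoi (fun=> 0%R) v r f g = f g.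
Proof.
move=> f0; elim: r g => [//|i r IH] g /=.
by rewrite convol_poi0// => ?; exact: cpoi_ge0.
Qed.

(** Superposition of Poisson vectors: commutation brings the two factors with the same jump [v i]
    together, and [convol_poiD] merges them. *)
Lemma cpoiD lam mu r f g :
  (forall i, (0 <= lam i)%R) -> (forall i, (0 <= mu i)%R) ->
  (forall g, 0 <= f g) ->
  cpoi lam v r (cpoi mu v r f) g = cpoi (fun i => lam i + mu i)%R v r f g.
Proof.
move=> lam0 mu0 f0; elim: r g => [//|i r IH] g /=.
etransitivity; last by apply: convol_poiD => // ?; exact: cpoi_ge0.
congr (convol _ _ _ g); apply/funext => g'.
rewrite -[LHS]convol_seqC; last by move=> ?; exact: cpoi_ge0.
exact: (congr1 (fun F => convol _ _ F g') (funext IH)).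
Qed.

(** Only the events of no jump at all and of exactly one jump are kept; they have probabilities
    exp(-L) and exp(-L) [lam i], where L is the total rate. *)
Lemma cpoi_ge lam r f g :
  (forall i, (0 <= lam i)%R) -> (forall g, 0 <= f g) ->
  (expR (- \sum_(i <- r) lam i))%:E *
    (f g + \sum_(i <- r) (lam i)%:E * f (g + v i)%R) <= cpoi lam v r f g.
Proof.
move=> lam0 f0; elim: r g => [|i r IH] g.
  by rewrite !big_nil oppr0 expR0 mul1e adde0.
have t0 (s : seq I) g' : 0 <= \sum_(i <- s) (lam i)%:E * f (g' + v i)%R.
  by apply: sume_ge0 => j _; rewrite mule_ge0// lee_fin.
apply: le_trans (convol_poi_ge _ _ (lam0 i) _); last first.
  by move=> ?; exact: cpoi_ge0.
rewrite !big_cons opprD expRD EFinM -muleA lee_wpmul2l ?lee_fin ?expR_ge0//.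
rewrite addeCA ge0_muleDr ?mule_ge0 ?adde_ge0 ?lee_fin// [leRHS]addeC.
apply: leeD; last exact: IH.
(* If the head of the list jumps once, the tail has to stay still: the induction hypothesis is used
   at the moved point, with its sum dropped. *)
rewrite muleCA lee_wpmul2l ?lee_fin//; apply: le_trans (IH _).
by rewrite lee_wpmul2l ?lee_fin ?expR_ge0// leeDl.
Qed.

End seq_index.

Section fin_index.
Context {I : finType} (v : I -> G).
Implicit Types (f : G -> \bar R).

Definition poisson_product (lam : I -> R) : probvec R {ffun I -> nat} :=
  prod_probvec (fun i => poi (lam i)).

Definition total_jump (z : {ffun I -> nat}) : G := (\sum_i jumps (v i) (z i))%R.

Lemma convol_poisson_product lam f g : (forall g, 0 <= f g) ->
  convol (poisson_product lam) total_jump f g = cpoi lam v (enum I) f g.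
Proof. exact: convol_prod. Qed.

Lemma convol_seq_poisson_product {J : choiceType} (lam : J -> I -> R)
    (s : seq J) f g :
  (forall j i, (0 <= lam j i)%R) -> (forall g, 0 <= f g) ->
  convol_seq (fun j => poisson_product (lam j)) (fun=> total_jump) s f g =
  cpoi (fun i => \sum_(j <- s) lam j i)%R v (enum I) f g.
Proof.
move=> lam0 f0; elim: s g => [|j s IH] g /=.
  by under eq_fun do rewrite big_nil; rewrite cpoi0.
rewrite (funext IH) convol_poisson_product; last by move=> ?; exact: cpoi_ge0.
rewrite cpoiD//; last by move=> i; apply: sumr_ge0.
by under [in RHS]eq_fun do rewrite big_cons.
Qed.

(* The rates alpha0 y0 and alpha1 y1 of the limit are junk and possibly negative,
   but they go with the jump 0. *)
Lemma cpoi_dist lam mu f g :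
  (forall i, v i != 0%R -> (0 <= lam i)%R /\ (0 <= mu i)%R) ->
  (forall g, 0 <= f g <= 1) ->
  cpoi lam v (enum I) f g <=
  cpoi mu v (enum I) f g + (\sum_(i | v i != 0%R) `|lam i - mu i|)%R%:E.
Proof.
move=> v0 f01; rewrite big_mkcond -big_enum.
apply: convol_seq_telescope => // [i|i f' g' f'01]; case: ifPn => // vi0.
  by have [? ?] := v0 _ vi0; exact: convol_poi_dist.
move: vi0; rewrite negbK => /eqP vi0.
by rewrite adde0 !convol0// => j; rewrite /jumps vi0 mul0rn.
Qed.

End fin_index.
End poisson_vector.

(** * Poisson approximation of the centered histogram *)

Section one_user.
Context {R : realType} {Y : finType}.
Implicit Types (W : bool -> probvec R Y) (f : Zvec Y -> \bar R) (b : bool).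

Lemma esum_finType (F : Y -> \bar R) : (forall y, 0 <= F y)%E ->
  (\esum_(y in [set: Y]) F y = \sum_y F y)%E.
Proof.
move=> F0; have -> : [set: Y] = [set` enum Y].
  by apply/seteqP; split=> y //= _; rewrite mem_enum.
by rewrite esum_fset// -fsbig_seq ?enum_uniq// big_enum.
Qed.

Lemma probvec_sum (p : probvec R Y) : \sum_y p y = 1.
Proof.
have := probvec_sum1 p; rewrite esum_finType => [|y].
  by rewrite sumEFin => -[].
by rewrite lee_fin probvec_ge0.
Qed.

Lemma probvec_sumN (p : probvec R Y) y0 : \sum_(y | y != y0) p y = 1 - p y0.
Proof. by rewrite -(probvec_sum p) [in RHS](bigD1 y0)//= addrAC subrr add0r. Qed.

Context (y0 y1 : Y).

Definition dominant b := if b then y1 else y0.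

(** The index pairs are the coordinates of [poisson_family]; a dominant output gives the jump 0. *)
Definition error_step (i : bool * Y) : Zvec Y :=
  basis_vec i.2 - basis_vec (dominant i.1).

(** Rates of the Poisson vector that replaces one user with input [b]. They are extended by 0 to all
    pairs, so that the rates of different users can be added. *)
Definition error_rate W b (i : bool * Y) : R :=
  if (i.1 == b) && (i.2 != dominant b) then W b i.2 else 0.

Definition user_error W b : R :=
  let p := 1 - W b (dominant b) in p * (1 - expR (- p)).

Lemma error_step_eq0 i : (error_step i == 0) = (i.2 == dominant i.1).
Proof.
rewrite /error_step subr_eq0; apply/eqP/eqP => [|-> //].
by move=> /ffunP/(_ i.2); rewrite !ffunE eqxx; case: eqP.
Qed.

Lemma error_rate_ge0 W b i : 0 <= error_rate W b i.
Proof. by rewrite /error_rate; case: ifP => // _; exact: probvec_ge0. Qed.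

Lemma user_error_ge0 W b : 0 <= user_error W b.
Proof.
have p0 : 0 <= 1 - W b (dominant b).
  by rewrite -probvec_sumN sumr_ge0// => y _; exact: probvec_ge0.
by rewrite mulr_ge0// subr_ge0 -[leRHS]expR0 ler_expR oppr_le0.
Qed.

Lemma big_error (V : nmodType) b (A : bool * Y -> V) :
  \sum_i (if (i.1 == b) && (i.2 != dominant b) then A i else 0) =
  \sum_(y | y != dominant b) A (b, y).
Proof.
rewrite -(big_pred1_eq +%R b (fun c => \sum_(y | y != dominant b) A (c, y))).
by rewrite pair_big/= -big_mkcond; apply: eq_bigr => -[].
Qed.

Lemma convol_user_le W b f g : (forall g, 0 <= f g <= 1)%E ->
  (convol (W b) (fun y => error_step (b, y)) f g <=
   convol (poisson_product (error_rate W b)) (total_jump error_step) f g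
   + (user_error W b)%:E)%E.
Proof.
(* The final inequality is one between reals, so [f] is replaced by its real-valued version. *)
move=> f01; pose F g := fine (f g).
have fE g' : f g' = (F g')%:E.
  have /andP[f0 f1] := f01 g'.
  by rewrite /F fineK// fin_numElt (lt_le_trans _ f0)// (le_lt_trans f1)// ltry.
have F01 g' : 0 <= F g' <= 1 by have := f01 g'; rewrite fE !lee_fin.
have f0 g' : (0 <= f g')%E by rewrite fE lee_fin; case/andP: (F01 g').
rewrite convol_poisson_product//.
apply: (le_trans _ (leeD2r _ (cpoi_ge error_step (enum _) g (error_rate_ge0 W b) f0))).
rewrite /convol esum_finType => [|y]; last first.
  by rewrite mule_ge0 ?lee_fin ?probvec_ge0.
have -> : \sum_(i <- enum {: bool * Y}) error_rate W b i = 1 - W b (dominant b).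
  by rewrite big_enum /error_rate big_error probvec_sumN.
rewrite big_enum/=; set S := \sum_(y | y != dominant b) W b y * F (g + error_step (b, y)).
have -> : (\sum_i (error_rate W b i)%:E * f (g + error_step i)%R = S%:E)%E.
  rewrite /S -sumEFin.
  rewrite -(big_error _ (fun i => (W b i.2 * F (g + error_step i))%:E)); apply: eq_bigr => i _.
  rewrite /error_rate fE; case: ifP => [/andP[/eqP <- _]|_]; last by rewrite mul0e.
  by rewrite -EFinM; case: i.
rewrite (bigD1 (dominant b))//=.
have /eqP -> : error_step (b, dominant b) == 0 by rewrite error_step_eq0.
under eq_bigr do rewrite fE -EFinM.
rewrite sumEFin -/S addr0 fE -!EFinM -!EFinD lee_fin /user_error.
set p := 1 - _; have {1}-> : W b (dominant b) = 1 - p by rewrite /p; ring.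
have /andP[S0 Sp] : 0 <= S <= p.
  rewrite /p -probvec_sumN; apply/andP; split.
    apply: sumr_ge0 => y _; rewrite mulr_ge0 ?probvec_ge0//.
    by case/andP: (F01 (g + error_step (b, y))).
  apply: ler_sum => y _; rewrite ler_piMr ?probvec_ge0//.
  by case/andP: (F01 (g + error_step (b, y))).
have /andP[c0 c1] := F01 g.
(* With e = exp(-p) and c = [F g], the goal reads (1 - p) c + S <= e (c + S) + p (1 - e). It follows
   from 1 - p <= e, which handles c, and from S <= p with e <= 1, which handles S. *)
have := expR_ge1Dx (- p); have : expR (- p) <= 1.
  by rewrite -[leRHS]expR0 ler_expR oppr_le0 (le_trans S0).
move: (expR (- p)) => e; nra.
Qed.

End one_user.

(** * Total variation and Le Cam distance *)

Section distances.
Context {R : realType}.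
Local Open Scope ereal_scope.

Lemma TV_ge0 d (T : measurableType d) (mu nu : set T -> \bar R) : 0 <= TV mu nu.
Proof.
apply: (@le_trans _ _ `|mu set0 - nu set0|) => //.
by apply: ereal_sup_ubound; exists set0.
Qed.

Lemma TV_le d (T : measurableType d) (mu nu : probability T R) (c : R) :
  (forall A, measurable A -> mu A <= nu A + c%:E) -> TV mu nu <= c%:E.
Proof.
move=> munu; apply: ge_ereal_sup => _ [A mA <-].
have := munu _ mA; have := munu _ (measurableC mA).
rewrite !probability_setC//.
rewrite -(fineK (fin_num_measure mu _ mA)) -(fineK (fin_num_measure nu _ mA)).
move: (fine _) (fine _) => x y.
rewrite -!EFinB -!EFinD /abse !lee_fin ler_norml => h1 h2.
by apply/andP; split; lra.
Qed.

Lemma TVC d (T : measurableType d) (mu nu : probability T R) :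
  TV mu nu = TV nu mu.
Proof.
rewrite /TV; congr ereal_sup; apply: eq_imagel => A mA.
rewrite -(fineK (fin_num_measure mu _ mA)) -(fineK (fin_num_measure nu _ mA)).
by rewrite -!EFinB /abse distrC.
Qed.

Lemma le_cam_ge0 d d' (T : measurableType d) (T' : measurableType d')
    (P Q : probability T R) (P' Q' : probability T' R) : 0 <= le_cam P Q P' Q'.
Proof.
rewrite le_max; apply/orP; left; apply: le_ereal_inf_tmp => _ [K _ <-].
by rewrite le_max TV_ge0.
Qed.

(** For experiments on the same space the identity kernel, here [kdirac] of the identity map, is a
    candidate in the infimum. *)
Lemma deficiency_le d (T : measurableType d) (P Q P' Q' : probability T R) :
  deficiency P Q P' Q' <= maxe (TV P P') (TV Q Q').
Proof.
have idP (mu : probability T R) (A : set T) : measurable A ->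
    apply_kernel mu (kdirac (@measurable_id _ T setT)) A = mu A.
  move=> mA; rewrite /apply_kernel.
  transitivity (\int[mu]_x (\1_A x)%:E); last by rewrite integral_indic// setIT.
  by apply: eq_integral => x _; rewrite /kdirac/= diracE indicE.
have TVid (mu nu : probability T R) :
    TV (apply_kernel mu (kdirac (@measurable_id _ T setT))) nu = TV mu nu.
  by rewrite /TV; congr ereal_sup; apply: eq_imagel => A mA; rewrite idP.
rewrite -[X in maxe X _]TVid -[X in maxe _ X]TVid.
apply: ereal_inf_lbound; eexists; last reflexivity.
by [].
Qed.

Lemma le_cam_le d (T : measurableType d) (P Q P' Q' : probability T R) :
  le_cam P Q P' Q' <= maxe (TV P P') (TV Q Q').
Proof.
by rewrite ge_max deficiency_le (TVC P) (TVC Q) deficiency_le.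
Qed.

End distances.

(** * Histograms, limit vector and bound in terms of error steps *)

Section shuffle.
Context {R : realType} {Y : finType} (y0 y1 : Y).
Implicit Types (W : bool -> probvec R Y).
Local Notation step := (error_step y0 y1).

Lemma sum_ord_lt (V : nmodType) n j (c0 c1 : V) : (j <= n)%N ->
  \sum_(i < n) (if (i < j)%N then c1 else c0) = c0 *+ (n - j) + c1 *+ j.
Proof.
move=> /subnKC <-; move: (n - j)%N => d; rewrite addKn big_split_ord/= addrC.
rewrite (eq_bigr (fun=> c0)) => [|i _]; last by rewrite ltnNge leq_addr.
rewrite [X in _ + X](eq_bigr (fun=> c1)) => [|i _]; last by rewrite ltn_ord.
by rewrite !sumr_const !card_ord.
Qed.

Lemma histogram_sum n (m : {ffun 'I_n -> Y}) :
  histogram m = \sum_i basis_vec (m i).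
Proof.
apply/ffunP => y; rewrite ffunE sum_ffunE.
under eq_bigr do rewrite ffunE.
rewrite -natz -sum1_card natr_sum big_mkcond/=; apply: eq_bigr => i _.
have -> : (i \in [set i | m i == y]) = (y == m i).
  by rewrite eq_sym; apply/idP/idP; rewrite inE.
by case: eqP.
Qed.

(** Each message vector is its error step plus the dominant vector for the user's input; the
    dominant vectors add up to the centering with j. *)
Lemma histogram_steps n j (m : {ffun 'I_n -> Y}) : (j <= n)%N ->
  histogram m = \sum_(i < n) step ((i < j)%N, m i)
                + basis_vec y0 *+ (n - j) + basis_vec y1 *+ j.
Proof.
move=> jn; rewrite -addrA -sum_ord_lt// -big_split histogram_sum.
apply: eq_bigr => i _; rewrite /error_step /= /dominant.
by case: ifP => _; rewrite subrK.
Qed.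

Lemma H_limitE UV : H_limit y0 y1 UV = total_jump step UV.
Proof.
have e b : \sum_y step (b, y) *+ UV (b, y) =
    \sum_(y | y != dominant y0 y1 b) step (b, y) *+ UV (b, y).
  rewrite [RHS]big_mkcond; apply: eq_bigr => y _; case: ifPn => //.
  by rewrite negbK => /eqP ->; rewrite /error_step subrr mul0rn.
rewrite /total_jump /jumps (eq_bigr (fun i => step (i.1, i.2) *+ UV (i.1, i.2))).
  by rewrite -(pair_bigA _ (fun b y => step (b, y) *+ UV (b, y))) big_bool /= !e addrC.
by case.
Qed.

(** The bound in the form in which the operator estimates produce it: one error per exchanged user,
    then one rate difference per nonzero jump. *)
Lemma tv_boundE W pi_lim alpha0 alpha1 n j :  (j <= n)%N ->
  tv_bound W pi_lim y0 y1 alpha0 alpha1 (n - j) j =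
  \sum_(i < n) user_error y0 y1 W (i < j)%N +
  \sum_(i | step i != 0) `|\sum_(l < n) error_rate y0 y1 W (l < j)%N i -
     (if i.1 then pi_lim * alpha1 i.2 else (1 - pi_lim) * alpha0 i.2)|.
Proof.
move=> jn; rewrite /tv_bound -!addrA addrA; congr (_ + _).
  rewrite (eq_bigr (fun i : 'I_n => if (i < j)%N then user_error y0 y1 W true
    else user_error y0 y1 W false)) => [|i _]; last by case: ifP.
  by rewrite sum_ord_lt// /user_error/= -!mulrA !mulr_natl.
pose A b y := `|(if b then j else (n - j)%N)%:R * W b y -
  (if b then pi_lim * alpha1 y else (1 - pi_lim) * alpha0 y)|.
transitivity (\sum_b \sum_(y | y != dominant y0 y1 b) A b y).
  by rewrite big_bool /= addrC.
rewrite pair_big_dep/=; apply: eq_big => -[b y] /=; first by rewrite error_step_eq0.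
move=> yb; rewrite /A (eq_bigr (fun l : 'I_n => if (l < j)%N then
  error_rate y0 y1 W true (b, y) else error_rate y0 y1 W false (b, y))); last first.
  by move=> l _; case: ifP.
rewrite sum_ord_lt// /error_rate/=; case: b yb => /= ->.
  by rewrite mul0rn add0r mulr_natl.
by rewrite mul0rn addr0 mulr_natl.
Qed.

End shuffle.

(** * The two total variation bounds for fixed n *)

Section poisson_approximation.
Context {R : realType} {Y : finType} (y0 y1 : Y).
Context (W : bool -> probvec R Y) (pi_lim : R) (alpha0 alpha1 : Y -> R).
Hypotheses (pi01 : 0 <= pi_lim <= 1)
  (alpha0_ge0 : forall y, y != y0 -> 0 <= alpha0 y)
  (alpha1_ge0 : forall y, y != y1 -> 0 <= alpha1 y).
Local Notation step := (error_step y0 y1).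
Local Notation rate := (error_rate y0 y1 W).

Let limit_rate (i : bool * Y) : R :=
  if i.1 then pi_lim * alpha1 i.2 else (1 - pi_lim) * alpha0 i.2.

Let limit_rate_ge0 i : step i != 0 -> 0 <= limit_rate i.
Proof.
rewrite error_step_eq0 /limit_rate; have /andP[? ?] := pi01.
by case: i => -[] y /= yd; rewrite mulr_ge0 ?subr_ge0 ?alpha0_ge0 ?alpha1_ge0.
Qed.

Lemma convol_messages_le n j (f : Zvec Y -> \bar R) g : (j <= n)%N ->
  (forall g, 0 <= f g <= 1)%E ->
  (convol (messages W n j)
     (fun m => \sum_(i < n) step ((i < j)%N, m i))%R f g <=
   convol (poisson_family pi_lim alpha0 alpha1) (total_jump step) f g +
   (tv_bound W pi_lim y0 y1 alpha0 alpha1 (n - j) j)%:E)%E.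
Proof.
move=> jn f01; have f0 g' : (0 <= f g')%E by have /andP[] := f01 g'.
rewrite (convol_prod _ (fun (i : 'I_n) y => step ((i < j)%N, y)))//.
(* [poisson_family] unfolds to [poisson_product limit_rate]. *)
rewrite [X in (_ <= X + _)%E](convol_poisson_product _ limit_rate)//.
rewrite tv_boundE// EFinD addeA.
(* The intermediate operator, where every user's message is replaced by a Poisson vector of the same
   error rates. *)
pose users := convol_seq
  (fun i : 'I_n => poisson_product (rate (i < j)%N)) (fun=> total_jump step).
apply: (@le_trans _ _ (users (enum 'I_n) f g +
  (\sum_(i < n) user_error y0 y1 W (i < j)%N)%:E)%E).
  rewrite -big_enum; apply: convol_seq_telescope => // [i|i f' g' f'01].
    exact: user_error_ge0.
  exact: convol_user_le.
(* Superposition turns [users] into a single Poisson vector with the summed rates, which [cpoi_dist]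
   compares with the limiting ones. *)
rewrite /users convol_seq_poisson_product// => [|i l]; last exact: error_rate_ge0.
rewrite addeAC leeD2r//.
apply: le_trans (cpoi_dist (mu := limit_rate) _ _ f01) _ => [i i0|].
  by split; [apply: sumr_ge0 => l _; exact: error_rate_ge0|exact: limit_rate_ge0].
rewrite leeD2l// lee_fin; apply: ler_sum => i _.
by rewrite big_enum.
Qed.

(** Common form of both bounds: the shift [g] is 0 for P and e_{y1} - e_{y0} for Q, and it only sets
    the point where the operators are evaluated. *)
Lemma TV_centered_law n k j g (H : {ffun bool * Y -> nat} -> Zvec Y) :
  (j <= n)%N ->
  (forall m : {ffun 'I_n -> Y}, centered y0 y1 n k (histogram m) =
     g + \sum_(i < n) step ((i < j)%N, m i)) ->
  (forall UV, H UV = g + H_limit y0 y1 UV) ->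
  (TV (centered_law W y0 y1 n k j) (law (poisson_family pi_lim alpha0 alpha1) H) <=
   (tv_bound W pi_lim y0 y1 alpha0 alpha1 (n - j) j)%:E)%E.
Proof.
move=> jn cE HE; apply: TV_le => A _.
have ind01 (g' : Zvec Y) : (0 <= (EFin \o \1_A : _ -> \bar R) g' <= 1)%E.
  by rewrite /= indicE; case: (_ \in _); rewrite !lee_fin ?ler01 ?lexx.
have := convol_messages_le g jn ind01.
by rewrite -(law_convol _ _ cE) -(law_convol _ _ (H' := H))// => UV; rewrite HE H_limitE.
Qed.

Lemma TV_P_limit n k : (k <= n)%N ->
  (TV (centered_law W y0 y1 n k k) (P_limit pi_lim y0 y1 alpha0 alpha1) <=
   (tv_bound W pi_lim y0 y1 alpha0 alpha1 (n - k) k)%:E)%E.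
Proof.
move=> kn; apply: (TV_centered_law (g := 0)) => // [m|UV]; rewrite add0r//.
by rewrite /centered (histogram_steps y0 y1 _ kn) addrAC !addrK.
Qed.

Lemma TV_Q_limit n k : (k < n)%N ->
  (TV (centered_law W y0 y1 n k k.+1) (Q_limit pi_lim y0 y1 alpha0 alpha1) <=
   (tv_bound W pi_lim y0 y1 alpha0 alpha1 (n - k - 1) k.+1)%:E)%E.
Proof.
move=> kn; rewrite -subnDA addn1.
apply: (TV_centered_law (g := basis_vec y1 - basis_vec y0)) => // [m|UV].
  rewrite /centered (histogram_steps y0 y1 _ kn).
  (* The centering uses k while k + 1 users have input 1: one e_{y0} too many and one e_{y1} too few
     are subtracted, which leaves the shift. *)
  rewrite (_ : (n - k)%N = (n - k.+1).+1)%N; last by rewrite -subSn.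
  rewrite !mulrS.
  move: (\sum_(i < n) _) (basis_vec y0 *+ _) (basis_vec y1 *+ k) => S u w.
  by apply/ffunP => y; rewrite !ffunE; ring.
by rewrite [RHS]addrC addrA.
Qed.

End poisson_approximation.

(** * Asymptotics of the bounds *)

Section inverse_order.
Context {R : realType}.
Implicit Types (u w : nat -> R).

(** O(1/n) with an explicit constant of arbitrary sign, which is easier to combine than [=O_]. *)
Definition Oinv u := exists C : R, \forall n \near \oo, `|u n| <= C * n%:R^-1.

Lemma OinvP u : u =O_\oo (fun n => n%:R^-1 : R) <-> Oinv u.
Proof.
rewrite eqO_exP; split=> [[C _ uC]|[C uC]].
  by exists C; apply: filterS uC => n; rewrite [`|_^-1|]ger0_norm ?invr_ge0.
exists (Num.max C 1); first by rewrite lt_max ltr01 orbT.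
apply: filterS uC => n /le_trans; apply.
by rewrite [`|_^-1|]ger0_norm ?invr_ge0// ler_wpM2r ?invr_ge0// le_max lexx.
Qed.

Lemma Oinv_near u w : {near \oo, u =1 w} -> Oinv u -> Oinv w.
Proof.
move=> uw [C uC]; exists C.
by near=> n; rewrite -(near uw n)//; near: n.
Unshelve. all: by end_near. Qed.

Lemma OinvD u w : Oinv u -> Oinv w -> Oinv (fun n => u n + w n).
Proof.
move=> [C uC] [D wD]; exists (C + D); near=> n.
rewrite (le_trans (ler_normD _ _))// mulrDl lerD//; by near: n.
Unshelve. all: by end_near. Qed.

Lemma Oinv_sum (I : Type) (r : seq I) (P : pred I) (u : I -> nat -> R) :
  (forall i, P i -> Oinv (u i)) -> Oinv (fun n => \sum_(i <- r | P i) u i n).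
Proof.
move=> uO; elim: r => [|i r IH].
  by exists 0; near=> n; rewrite big_nil normr0 mul0r.
case Pi : (P i); last by under eq_fun do rewrite big_cons Pi.
by under eq_fun do rewrite big_cons Pi; apply: OinvD => //; exact: uO.
Unshelve. all: by end_near. Qed.

Lemma Oinv_norm u : Oinv u -> Oinv (fun n => `|u n|).
Proof. by move=> [C uC]; exists C; apply: filterS uC => n; rewrite normr_id. Qed.

(** The convergent factor is eventually at most [|l| + 1] in absolute value. *)
Lemma OinvM u w (l : R) : u n @[n --> \oo] --> l -> Oinv w ->
  Oinv (fun n => u n * w n).
Proof.
move=> ul [C wC]; exists ((`|l| + 1) * C); near=> n.
rewrite normrM -mulrA ler_pM//; last by near: n.
by near: n; apply: cvgr_le (cvg_norm ul) _ _; rewrite ltrDl.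
Unshelve. all: by end_near. Qed.

Lemma Oinv_inv : Oinv (fun n => n%:R^-1).
Proof.
by exists 1; near=> n; rewrite mul1r ger0_norm ?invr_ge0.
Unshelve. all: by end_near. Qed.

Lemma cvgn_inv : (n%:R^-1 : R) @[n --> \oo] --> (0 : R).
Proof.
apply/gtr0_cvgV0; last exact: cvgr_idn.
by near=> n; rewrite ltr0n; near: n; exact: nbhs_infty_gt.
Unshelve. all: by end_near. Qed.

Lemma Oinv_of_cvg u (l : R) : n%:R * u n @[n --> \oo] --> l -> Oinv u.
Proof.
move=> ul; apply: (Oinv_near _ (OinvM ul Oinv_inv)); near=> n.
have n0 : (n%:R : R) != 0.
  by rewrite pnatr_eq0 -lt0n; near: n; exact: nbhs_infty_gt.
by rewrite mulrAC divff// mul1r.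
Unshelve. all: by end_near. Qed.

Lemma Oinv_cvg u : Oinv u -> u n @[n --> \oo] --> (0 : R).
Proof.
move=> [C uC]; apply/norm_cvg0P.
have C0 : C * n%:R^-1 @[n --> \oo] --> (0 : R).
  by rewrite -[X in _ --> X](mulr0 C); apply: cvgM; [exact: cvg_cst|exact: cvgn_inv].
apply: (squeeze_cvgr _ (cvg_cst 0) C0).
by apply: filterS uC => n ->; rewrite normr_ge0.
Qed.

End inverse_order.

(** * Limits and rates of the terms of the bound *)

Section asymptotics.
Context {R : realType}.

Section one_intensity.
Context (a : nat -> nat) (c : R) (w : nat -> R) (alpha : R).
Hypotheses (ac : (a n)%:R / n%:R @[n --> \oo] --> c)
  (wa : n%:R * w n @[n --> \oo] --> alpha).

(** Here [a n] is the size of a group of users with the same input and [c] its limiting share; both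
    lemmas below rest on this factorization for n > 0. *)
Let aw_eq : {near \oo, (fun n => ((a n)%:R / n%:R) * (n%:R * w n)) =1
  (fun n => (a n)%:R * w n)}.
Proof.
near=> n; have n0 : (n%:R : R) != 0.
  by rewrite pnatr_eq0 -lt0n; near: n; exact: nbhs_infty_gt.
by field.
Unshelve. all: by end_near. Qed.

Lemma intensity_cvg : (a n)%:R * w n @[n --> \oo] --> c * alpha.
Proof. exact: cvg_trans (near_eq_cvg aw_eq) (cvgM ac wa). Qed.

(** With s = a/n, the difference is s (n w - alpha) + alpha (s - c). *)
Lemma intensity_Oinv : Oinv (fun n => (a n)%:R / n%:R - c) ->
  Oinv (fun n => n%:R * w n - alpha) -> Oinv (fun n => (a n)%:R * w n - c * alpha).
Proof.
move=> aO wO.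
apply: (Oinv_near _ (OinvD (OinvM ac wO) (OinvM (cvg_cst alpha) aO))).
near=> n; rewrite -(near aw_eq n)//; ring.
Unshelve. all: by end_near. Qed.

End one_intensity.

Section one_group.
Context {Y : finType} (a : nat -> nat) (c : R) (w : nat -> probvec R Y) (d : Y)
  (alpha : Y -> R).
Hypotheses (ac : (a n)%:R / n%:R @[n --> \oo] --> c)
  (wa : forall y, y != d -> n%:R * w n y @[n --> \oo] --> alpha y).
Let p n := 1 - w n d.

Let np_cvg : n%:R * p n @[n --> \oo] --> \sum_(y | y != d) alpha y.
Proof.
under eq_fun do rewrite /p -probvec_sumN mulr_sumr.
by apply: cvg_big => [|y yd]; [exact: add_continuous|exact: wa].
Qed.

Let p_Oinv : Oinv p. Proof. exact: Oinv_of_cvg np_cvg. Qed.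

Let p_ge0 n : 0 <= p n.
Proof. by rewrite /p -probvec_sumN sumr_ge0// => y _; exact: probvec_ge0. Qed.

(** The factor a p converges and 1 - exp(-p) <= p = O(1/n), so this term has order 1/n already in
    the critical regime, with no rate assumed for the intensities. *)
Lemma group_error_Oinv : Oinv (fun n => (a n)%:R * p n * (1 - expR (- p n))).
Proof.
apply: OinvM (intensity_cvg ac np_cvg) _.
have [C pC] := p_Oinv; exists C; apply: filterS pC => n; apply: le_trans.
rewrite [leRHS]ger0_norm// ger0_norm; last first.
  by rewrite subr_ge0 -[leRHS]expR0 ler_expR oppr_le0.
by have := expR_ge1Dx (- p n); lra.
Qed.

Lemma group_intensity_cvg :
  \sum_(y | y != d) `|(a n)%:R * w n y - c * alpha y| @[n --> \oo] --> (0 : R).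
Proof.
rewrite [X in _ --> X](_ : 0 = \sum_(y | y != d) 0 :> R); last by rewrite big1.
apply: cvg_big => [|y yd]; first exact: add_continuous.
apply/norm_cvg0P; rewrite -(subrr (c * alpha y)); apply: cvgB; last exact: cvg_cst.
exact: intensity_cvg ac (wa yd).
Qed.

Lemma group_intensity_Oinv : Oinv (fun n => (a n)%:R / n%:R - c) ->
  (forall y, y != d -> Oinv (fun n => n%:R * w n y - alpha y)) ->
  Oinv (fun n => \sum_(y | y != d) `|(a n)%:R * w n y - c * alpha y|).
Proof.
move=> aO wO; apply: Oinv_sum => y yd; apply: Oinv_norm.
exact: intensity_Oinv ac aO (wO _ yd).
Qed.

End one_group.

Section tv_bound.
Context {Y : finType} (W : nat -> bool -> probvec R Y) (y0 y1 : Y)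
  (alpha0 alpha1 : Y -> R) (a b : nat -> nat) (pi_lim : R).
Hypotheses (W_critical : sparse_error_critical W y0 y1 alpha0 alpha1)
  (a_cvg : (a n)%:R / n%:R @[n --> \oo] --> 1 - pi_lim)
  (b_cvg : (b n)%:R / n%:R @[n --> \oo] --> pi_lim).
Let bound n := tv_bound (W n) pi_lim y0 y1 alpha0 alpha1 (a n) (b n).

(** The group sizes [a] and [b] stay general, to serve both (n - k, k) and (n - k - 1, k + 1). *)
Lemma tv_bound_cvg : bound n @[n --> \oo] --> (0 : R).
Proof.
have [_ _ _ W0 W1 _ _] := W_critical.
rewrite /bound /tv_bound -[X in _ --> X]addr0 -[X in _ --> X + _]addr0 -[X in _ --> X + _ + _]addr0.
apply: cvgD; last exact: (group_intensity_cvg b_cvg W1).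
apply: cvgD; last exact: (group_intensity_cvg a_cvg W0).
by apply: cvgD; apply: Oinv_cvg;
  [exact: group_error_Oinv a_cvg W0|exact: group_error_Oinv b_cvg W1].
Qed.

Lemma tv_bound_Oinv :
  Oinv (fun n => (a n)%:R / n%:R - (1 - pi_lim)) ->
  Oinv (fun n => (b n)%:R / n%:R - pi_lim) ->
  (forall y, y != y0 -> Oinv (fun n => n%:R * W n false y - alpha0 y)) ->
  (forall y, y != y1 -> Oinv (fun n => n%:R * W n true y - alpha1 y)) ->
  Oinv bound.
Proof.
have [_ _ _ W0 W1 _ _] := W_critical => aO bO W0O W1O.
apply: OinvD; last exact: (group_intensity_Oinv b_cvg).
apply: OinvD; last exact: (group_intensity_Oinv a_cvg).
by apply: OinvD; [exact: group_error_Oinv a_cvg W0|exact: group_error_Oinv b_cvg W1].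
Qed.

End tv_bound.
End asymptotics.

Lemma squeeze_ereal (R : realType) (u : nat -> \bar R) (v : nat -> R) :
  (\forall n \near \oo, 0 <= u n <= (v n)%:E)%E ->
  v n @[n --> \oo] --> (0 : R) -> u n @[n --> \oo] --> 0%E.
Proof.
move=> uv v0; apply: (squeeze_cvge uv (cvg_cst _)).
by apply: cvg_EFin => //; exact: nearW.
Qed.

Theorem theorem5p8 (R : realType) (Y : finType)
    (W : nat -> bool -> probvec R Y) (y0 y1 : Y) (alpha0 alpha1 : Y -> R)
    (k : nat -> nat) (pi_lim : R)
    (k_lt : forall n, (0 < n)%N -> (k n < n)%N)
    (pi01 : 0 <= pi_lim <= 1)
    (k_cvg : (k n)%:R / n%:R @[n --> \oo] --> pi_lim)
    (W_critical : sparse_error_critical W y0 y1 alpha0 alpha1) :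
  let P n := centered_law (W n) y0 y1 n (k n) (k n) in
  let Q n := centered_law (W n) y0 y1 n (k n) (k n).+1 in
  let Poo := P_limit pi_lim y0 y1 alpha0 alpha1 in
  let Qoo := Q_limit pi_lim y0 y1 alpha0 alpha1 in
  let boundP n := tv_bound (W n) pi_lim y0 y1 alpha0 alpha1 (n - k n) (k n) in
  let boundQ n :=
    tv_bound (W n) pi_lim y0 y1 alpha0 alpha1 (n - k n - 1) (k n).+1 in
  [/\ TV (P n) Poo @[n --> \oo] --> 0%E,
      TV (Q n) Qoo @[n --> \oo] --> 0%E,
      le_cam (P n) (Q n) Poo Qoo @[n --> \oo] --> 0%E,
      forall n, (0 < n)%N ->
        (TV (P n) Poo <= (boundP n)%:E)%E /\ (TV (Q n) Qoo <= (boundQ n)%:E)%E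
    & (fun n => (k n)%:R / n%:R - pi_lim : R) =O_\oo (fun n => n%:R^-1 : R) ->
      (forall y, y != y0 ->
        (fun n => n%:R * W n false y - alpha0 y : R)
          =O_\oo (fun n => n%:R^-1 : R)) ->
      (forall y, y != y1 ->
        (fun n => n%:R * W n true y - alpha1 y : R)
          =O_\oo (fun n => n%:R^-1 : R)) ->
      boundP =O_\oo (fun n => n%:R^-1 : R) /\
      boundQ =O_\oo (fun n => n%:R^-1 : R)].

Proof.
move=> P Q Poo Qoo boundP boundQ.
have [_ A0 A1 _ _ _ _] := W_critical.
have TVP n : (0 < n)%N -> (TV (P n) Poo <= (boundP n)%:E)%E.
  by move=> n0; apply: TV_P_limit => //; exact/ltnW/k_lt.
have TVQ n : (0 < n)%N -> (TV (Q n) Qoo <= (boundQ n)%:E)%E.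
  by move=> n0; apply: TV_Q_limit => //; exact: k_lt.
have n_gt0 : \forall n \near \oo, (0 < n)%N by exact: nbhs_infty_gt.
(* The group shares equal the real expressions only eventually: n > 0 gives k < n, which makes the
   truncated subtractions exact. *)
have aP : {near \oo, (fun n => 1 - (k n)%:R / n%:R) =1
    (fun n => (n - k n)%:R / n%:R : R)}.
  near=> n; have n0 : (0 < n)%N by near: n.
  rewrite natrB; last exact/ltnW/k_lt.
  by rewrite mulrBl divff// pnatr_eq0 -lt0n.
have aQ : {near \oo, (fun n => 1 - (k n)%:R / n%:R - n%:R^-1) =1
    (fun n => (n - k n - 1)%:R / n%:R : R)}.
  near=> n; have n0 : (0 < n)%N by near: n.
  have kn := k_lt n n0; rewrite !natrB ?subn_gt0//; last exact/ltnW.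
  by rewrite !mulrBl divff ?mul1r// pnatr_eq0 -lt0n.
have bQE : (fun n => (k n)%:R / n%:R + n%:R^-1) =
    (fun n => (k n).+1%:R / n%:R : R).
  by apply/funext => n; rewrite -natr1 mulrDl mul1r.
have aP_cvg : (n - k n)%:R / n%:R @[n --> \oo] --> 1 - pi_lim.
  exact: cvg_trans (near_eq_cvg aP) (cvgB (cvg_cst (1 : R)) k_cvg).
have aQ_cvg : (n - k n - 1)%:R / n%:R @[n --> \oo] --> 1 - pi_lim.
  rewrite -[X in _ --> X]subr0.
  exact: cvg_trans (near_eq_cvg aQ) (cvgB (cvgB (cvg_cst (1 : R)) k_cvg) cvgn_inv).
have bQ_cvg : (k n).+1%:R / n%:R @[n --> \oo] --> pi_lim.
  by rewrite -bQE -[X in _ --> X]addr0; apply: cvgD => //; exact: cvgn_inv.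
have boundP0 : boundP n @[n --> \oo] --> (0 : R) by exact: tv_bound_cvg.
have boundQ0 : boundQ n @[n --> \oo] --> (0 : R) by exact: tv_bound_cvg.
split.
- apply: squeeze_ereal boundP0; near=> n.
  by rewrite TV_ge0 TVP//; near: n.
- apply: squeeze_ereal boundQ0; near=> n.
  by rewrite TV_ge0 TVQ//; near: n.
(* The maximum of the two distances is bounded by the sum of the absolute values, whose limit is
   immediate. *)
- have b0 : `|boundP n| + `|boundQ n| @[n --> \oo] --> (0 : R).
    have e0 : `|0 : R| + `|0 : R| = 0 by rewrite normr0 addr0.
    rewrite -[X in _ --> X]e0.
    exact: cvgD (cvg_norm boundP0) (cvg_norm boundQ0).
  apply: squeeze_ereal b0; near=> n; have n0 : (0 < n)%N by near: n.
  rewrite le_cam_ge0 (le_trans (le_cam_le _ _ _ _))// ge_max.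
  rewrite (le_trans (TVP n n0)) ?(le_trans (TVQ n n0))// lee_fin.
    by rewrite (le_trans (ler_norm _))// lerDr.
  by rewrite (le_trans (ler_norm _))// lerDl.
- by move=> n n0; split; [exact: TVP|exact: TVQ].
move=> /OinvP kO W0O W1O.
have W0O' y : y != y0 -> Oinv (fun n => n%:R * W n false y - alpha0 y).
  by move=> /W0O/OinvP.
have W1O' y : y != y1 -> Oinv (fun n => n%:R * W n true y - alpha1 y).
  by move=> /W1O/OinvP.
have aPO : Oinv (fun n => (n - k n)%:R / n%:R - (1 - pi_lim)).
  (* The deviation of the share (n - k)/n is minus that of k/n, hence the constant factor -1. *)
  apply: (Oinv_near _ (OinvM (cvg_cst (-1 : R)) kO)); near=> n.
  rewrite -(near aP n)//; ring.
have aQO : Oinv (fun n => (n - k n - 1)%:R / n%:R - (1 - pi_lim)).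
  apply: (Oinv_near _ (OinvM (cvg_cst (-1 : R)) (OinvD kO Oinv_inv))); near=> n.
  rewrite -(near aQ n)//; ring.
have bQO : Oinv (fun n => (k n).+1%:R / n%:R - pi_lim).
  apply: (Oinv_near _ (OinvD kO Oinv_inv)); near=> n.
  by rewrite addrAC (congr1 (fun u => u n) bQE).
by split; apply/OinvP; apply: tv_bound_Oinv.
Unshelve. all: by end_near. Qed.
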